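(* Let $\mathcal{C}_\delta=\{p_i\}_{i=1}^N$ be a configuration over a Hirzebruch surface $\mathbb{F}_\delta$, $\delta\ge 0$, giving rise to the smooth rational surface $Z_{\mathcal{C}_\delta}$. For $\delta>0$ (respectively, $\delta=0$) denote by $\mathcal{S}$ the set formed by $M_0^\delta$ and the curves in $|F^\delta|$ passing through some point in $\mathcal{C}_\delta$ (respectively, the set of curves in $|F^0|\cup |M^0|$ passing through some point in $\mathcal{C}_{0}$). Set $\alpha :=\min\{\tilde{C}^2\mid C\in \mathcal{S}\}$ and $\beta:=\min\{\tilde{E}_{p_i}^2\mid i=1,\ldots,N\}$. Let $\mathbf{a}=\mathbf{a}(\mathrm{APG}(Z_{\mathcal{C}_\delta},\pi_{\mathcal{C}_\delta}))$ and let $\omega(\mathcal{C}_\delta)$ be the value defined in the context. Then: (a) If $\delta>0$ and $\delta\geq \mathbf{a}$, then for any integral curve $C$ on $Z_{\mathcal{C}_\delta}$ one has $C^2\geq \min\{\alpha,\beta\}$. (b) If $\delta=0$, or $\delta>0$ and $\delta< \mathbf{a}$, the inequality $$\frac{C^2}{(H^*\cdot C)^2}\geq \min\{\alpha,-\omega(\mathcal{C}_\delta)\}$$ holds for any nef divisor $H$ on $\mathbb{F}_\delta$ and for any integral curve $C$ on $Z_{\mathcal{C}_\delta}$ such that $H^*\cdot C>0$.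
   Context: Everything is over an algebraically closed field $k$ of arbitrary characteristic; integral means reduced and irreducible. Hirzebruch surfaces: $\mathbb{F}_\delta=\mathbb{P}(\mathcal{O}_{\mathbb{P}^1}\oplus\mathcal{O}_{\mathbb{P}^1}(\delta))$, $\delta\in\mathbb{Z}_{\ge0}$, with ruling $\sigma_\delta:\mathbb{F}_\delta\to\mathbb{P}^1$; $F^\delta$ is a general fiber, $M_0^\delta$ the special section and $M^\delta$ a section disjoint from it, with $(F^\delta)^2=0$, $(M^\delta)^2=\delta$, $(M_0^\delta)^2=-\delta$, $F^\delta\cdot M^\delta=F^\delta\cdot M_0^\delta=1$, $M^\delta\cdot M_0^\delta=0$. If $\delta=0$, $M_0^0\sim M^0$ and $\mathbb{F}_0=\mathbb{P}^1\times\mathbb{P}^1$. Configurations: a configuration over $X_0$ is a non-empty set $\{p_i\}_{i=1}^N$ with $p_i$ a closed point of $X_{i-1}$, where $X_i\to X_{i-1}$ is the blowup at $p_i$. For $X_0=\mathbb{F}_\delta$ the composition of these blowups is $\pi_{\mathcal{C}_\delta}:Z_{\mathcal{C}_\delta}=X_N\to\mathbb{F}_\delta$. $E_{p_i}$ is the exceptional divisor created by blowing up $p_i$. $D^*$ and $\tilde D$ denote the total and strict transform on $Z_{\mathcal{C}_\delta}$. The point $p_j$ is proximate to $p_i$ ($p_j\to p_i$) if $j>i$ and $p_j$ lies on the strict transform of $E_{p_i}$ on $X_{j-1}$. A smooth curve $D\subset X_0$ goes through $p_i$ (in the infinitely near sense) if the strict transform of $D$ on $X_{i-1}$ contains $p_i$.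 The value $\mathbf{a}$: let $K\subset\mathbb{R}^{N+2}$ be the cone of vectors $(x,y,m_{1},\dots,m_{N})$ such that $m_{i}\ge\sum_{p_j\to p_i}m_{j}$ for all $i$; $y\ge\sum_{p_i\in F}m_i$ for every fiber $F$ of $\mathbb{F}_\delta$ through some point of $\mathcal{C}_\delta\cap\mathbb{F}_\delta$ (the sum over the $p_i$ that $F$ goes through in the infinitely near sense); and $x\ge\sum_{p_i\in M_0^\delta}m_i$ (the sum over the $p_i$ that $M_0^\delta$ goes through in the infinitely near sense). ($K$ is the dual cone of the cone generated by the classes of all $\tilde E_{p_i}$, of the strict transforms of these fibers and of $\tilde M_0^\delta$, in coordinates $x(F^\delta)^*+y(M^\delta)^*-\sum m_iE_{p_i}^*$.) Then $\mathbf{a}(\mathrm{APG}(Z_{\mathcal{C}_\delta},\pi_{\mathcal{C}_\delta}))$ is the smallest positive integer $t$ such that $2xy+ty^2-\sum_i m_i^2\ge0$ for all vectors in $K$. It depends only on the arrowed proximity graph APG, i.e. on the proximity relations and on which points the fibers and the special section go through. The value $\omega(\mathcal{C}_\delta)$: for $0<\delta<\mathbf{a}$, $\omega(\mathcal{C}_\delta):=\mathbf{a}-\delta$. For $\delta=0$, any curve $R\in|M^0|$ can play the role of the special section; $\mathbf{a}_1(\mathcal{C}_0)$ is the minimum, over all $R\in|M^0|$, of the smallest positive integer $t$ such that $2xy+ty^2-\sum_i m_i^2\ge0$ for all $(x,y,m_1,\dots,m_N)$ with $m_i\ge\sum_{p_j\to p_i}m_j$ for all $i$, $y\ge\sum_{p_i\in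 F}m_i$ for each $F\in|F^0|$ through some point of $\mathcal{C}_0\cap\mathbb{F}_0$, and $x\ge\sum_{p_i\in R}m_i$ (that is, with $R$ in place of $M_0^0$). The value $\mathbf{a}_2(\mathcal{C}_0)$ is obtained in the same way after exchanging the roles of $|F^0|$ and $|M^0|$ (using the other ruling): it is the minimum over all $R\in|F^0|$ of the smallest positive integer $t$ such that $2xy+tx^2-\sum_i m_i^2\ge0$ for all $(x,y,m_1,\dots,m_N)$ with $m_i\ge\sum_{p_j\to p_i}m_j$ for all $i$, $x\ge\sum_{p_i\in M}m_i$ for each $M\in|M^0|$ through some point of $\mathcal{C}_0\cap\mathbb{F}_0$, and $y\ge\sum_{p_i\in R}m_i$. Then $\omega(\mathcal{C}_0):=\max\{\mathbf{a}_1(\mathcal{C}_0),\mathbf{a}_2(\mathcal{C}_0)\}$. *)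

(* Defs.v *)
From HB Require Import structures.
From mathcomp Require Import all_boot all_order all_algebra.
From mathcomp Require Import mpoly.
From mathcomp Require Import boolp classical_sets reals.

Set Implicit Arguments.
Unset Strict Implicit.
Unset Printing Implicit Defensive.

Import Order.TTheory GRing.Theory Num.Theory.

Local Open Scope classical_set_scope.
Local Open Scope ring_scope.

(* Hirzebruch surfaces and their iterated point blowups are described in      *)
(* explicit coordinates.                                                      *)
(*   F_delta is the quotient of (A^2 - 0) x (A^2 - 0), with coordinates       *)
(* (s0, s1; u0, u1), by G_m^2 acting by                                       *)
(*   (l, m).(s0, s1; u0, u1) = (l s0, l s1; l^-delta m u0, m u1).             *)
(* The ruling is [s0 : s1], and the homogeneous coordinate ring               *)
(* k[s0, s1, u0, u1] is graded by Pic F_delta = Z F + Z M:                    *)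
(*   s0, s1 : F     u0 : M - delta F = M_0     u1 : M                         *)
(* Effective divisors of class x F + y M are the nonzero homogeneous elements *)
(* of bidegree (x, y) (up to a constant factor); the integral ones are those  *)
(* given by irreducible elements.                                             *)

(* intersection form on Pic F_delta: F.F = 0, F.M = 1, M.M = delta *)
Definition dotF (delta : nat) (c d : int * int) : int :=
  c.1 * d.2 + c.2 * d.1 + delta%:Z * (c.2 * d.2).

(* x0 is a junk value, returned only if A has no least element *)
Definition least d (T : porderType d) (x0 : T) (A : set T) : T :=
  xget x0 [set a | A a /\ forall b, A b -> (a <= b)%O].

Section EffectiveDivisors.
Variable k : closedFieldType.

Definition is0 : 'I_4 := @Ordinal 4 0 isT.
Definition is1 : 'I_4 := @Ordinal 4 1 isT.
Definition iu0 : 'I_4 := @Ordinal 4 2 isT.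
Definition iu1 : 'I_4 := @Ordinal 4 3 isT.

Definition bihomogeneous (delta : nat) (x y : int) (f : {mpoly k[4]}) : Prop :=
  forall m, m \in msupp f ->
    (m is0)%:Z + (m is1)%:Z - delta%:Z * (m iu0)%:Z = x
    /\ (m iu0)%:Z + (m iu1)%:Z = y.

Record effdiv (delta : nat) := EffDiv {
  eqn : {mpoly k[4]};
  clsF : int;
  clsM : int;
  eqn_neq0 : eqn != 0;
  eqn_bihom : bihomogeneous delta clsF clsM eqn }.

Definition integral_div delta (D : effdiv delta) : Prop :=
  eqn D \isn't a GRing.unit
  /\ forall g h : {mpoly k[4]}, eqn D = g * h ->
       g \is a GRing.unit \/ h \is a GRing.unit.

Definition linsys delta (x y : int) : set (effdiv delta) :=
  [set D | clsF D = x /\ clsM D = y].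
Definition linsysF delta : set (effdiv delta) := linsys 1 0.
Definition linsysM delta : set (effdiv delta) := linsys 0 1.

Lemma M0_neq0 : 'X_iu0 != 0 :> {mpoly k[4]}.
Proof. by rewrite -msupp_eq0 msuppX. Qed.

Lemma M0_bihom delta : bihomogeneous delta (- delta%:Z) 1 'X_iu0.
Proof.
move=> m; rewrite msuppX inE => /eqP ->.
by rewrite !mnm1E /= mulr1 !add0r addr0.
Qed.

Definition M0 delta : effdiv delta := EffDiv M0_neq0 (@M0_bihom delta).

End EffectiveDivisors.

Section InfinitelyNearPoints.
Variable k : closedFieldType.

(* Some a is [1 : a], None is [0 : 1] *)
Definition P1 := option k.

(* ((b, v), ds) is a closed point of F_delta or infinitely near to F_delta.   *)
(* ((b, v), [::]) is the point [s0 : s1] = b, [u0 : u1] = v, each pair being  *)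
(* normalized as (1, a) or (0, 1).  If q = (o, ds), then (o, d :: ds) is the  *)
(* point d of the exceptional divisor (a projective line) of the blowup of q. *)
Definition ipoint := ((P1 * P1) * seq P1)%type.

Definition proper (q : ipoint) : bool := nilp q.2.

(* q is a closed point of the surface obtained from F_delta by blowing up the *)
(* points in c: it lies on F_delta or on the exceptional divisor of a point   *)
(* of c, and it has not been replaced by an exceptional divisor itself.       *)
Definition on_blowup (c : seq ipoint) (q : ipoint) : bool :=
  (q \notin c) && (if q.2 is _ :: ds then (q.1, ds) \in c else true).

Definition is_config N (p : 'I_N -> ipoint) : Prop :=
  (0 < N)%N
  /\ forall i : 'I_N,
       on_blowup [seq p j | j : 'I_N <- enum 'I_N & (j < i)%N] (p i).

Definition U : {mpoly k[2]} := 'X_(@Ordinal 2 0 isT).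
Definition V : {mpoly k[2]} := 'X_(@Ordinal 2 1 isT).

(* Local equation of {f = 0} at a point of F_delta, in coordinates U (on the  *)
(* base) and V (on the fiber) centered at that point.                         *)
Definition local_coords (b : P1) (t : {mpoly k[2]}) : {mpoly k[2]} * {mpoly k[2]} :=
  if b is Some a then (1, a%:MP + t) else (t, 1).

Definition local_eq0 (o : P1 * P1) (f : {mpoly k[4]}) : {mpoly k[2]} :=
  let s := local_coords o.1 U in
  let u := local_coords o.2 V in
  comp_mpoly [tuple s.1; s.2; u.1; u.2] f.

(* order of vanishing at the origin (for f != 0) *)
Definition vorder (f : {mpoly k[2]}) : nat :=
  \big[minn/msize f]_(m <- msupp f) mdeg m.

(* Strict transform, in coordinates centered at the point d of the            *)
(* exceptional divisor of the blowup of the origin:                           *)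
(*   f(U, U (V + a)) / U^(vorder f) for d = Some a, exceptional divisor U = 0   *)
(*   f(U V, V) / V^(vorder f)       for d = None,   exceptional divisor V = 0   *)
Definition strict_tr (d : P1) (f : {mpoly k[2]}) : {mpoly k[2]} :=
  \sum_(m <- msupp f)
    f@_m *: (if d is Some a
             then U ^+ (mdeg m - vorder f) * (V + a%:MP) ^+ m (@Ordinal 2 1 isT)
             else U ^+ m (@Ordinal 2 0 isT) * V ^+ (mdeg m - vorder f)).

Definition exc_eq (d : P1) : {mpoly k[2]} := if d is Some _ then U else V.

(* local equation at q of the strict transform of {f = 0} *)
Definition local_eq (f : {mpoly k[4]}) (q : ipoint) : {mpoly k[2]} :=
  foldr strict_tr (local_eq0 q.1 f) q.2.

Definition mult delta (D : effdiv k delta) (q : ipoint) : nat :=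
  vorder (local_eq (eqn D) q).

Definition through delta (D : effdiv k delta) (q : ipoint) : bool :=
  (0 < mult D q)%N.

(* Local equation at (o, ds) of the strict transform of the exceptional       *)
(* divisor of q; it is 1 if (o, ds) is not infinitely near to q.              *)
Fixpoint exc_local_eq (q : ipoint) (o : P1 * P1) (ds : seq P1) : {mpoly k[2]} :=
  if ds is d :: ds' then
    if (o, ds') == q then exc_eq d else strict_tr d (exc_local_eq q o ds')
  else 1.

Definition on_exc (q r : ipoint) : bool :=
  (0 < vorder (exc_local_eq q r.1 r.2))%N.

Definition proximate N (p : 'I_N -> ipoint) (j i : 'I_N) : bool :=
  (i < j)%N && on_exc (p i) (p j).

End InfinitelyNearPoints.

Section BlownUpSurface.
Variables (k : closedFieldType) (delta N : nat) (p : 'I_N -> ipoint k).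

(* ZCls x y m is the class x F^* + y M^* - \sum_i m i E_{p_i}^* in Pic Z *)
Record zcls := ZCls { zF : int; zM : int; zE : 'I_N -> int }.

Definition dot (c d : zcls) : int :=
  dotF delta (zF c, zM c) (zF d, zM d) - \sum_(i < N) zE c i * zE d i.

Definition strict_cls (D : effdiv k delta) : zcls :=
  ZCls (clsF D) (clsM D) (fun i => (mult D (p i))%:Z).

(* \tilde E_{p_i} = E_{p_i}^* - \sum_(p_j -> p_i) E_{p_j}^* *)
Definition exc_cls (i : 'I_N) : zcls :=
  ZCls 0 0 (fun j => (proximate p j i)%:Z - (j == i)%:Z).

(* An integral curve on Z is either contracted by Z -> F_delta, and then it is *)
(* some \tilde E_{p_i}, or the strict transform of its image.                  *)
Inductive zcurve :=
| Strict (D : effdiv k delta) of integral_div D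
| Exc of 'I_N.

Definition curve_cls (C : zcurve) : zcls :=
  match C with
  | Strict D _ => strict_cls D
  | Exc i => exc_cls i
  end.

(* A divisor on F_delta is represented by its class h.1 F + h.2 M *)
Definition nef (h : int * int) : Prop :=
  forall D : effdiv k delta, integral_div D ->
    0 <= dotF delta h (clsF D, clsM D).

Definition pullback (h : int * int) : zcls := ZCls h.1 h.2 (fun=> 0).

Definition through_some (D : effdiv k delta) : Prop :=
  exists i, through D (p i).

Definition curvesS : set (effdiv k delta) :=
  if delta == 0%N
  then [set D | (linsysF D \/ linsysM D) /\ through_some D]
  else [set D | D = M0 k delta \/ (linsysF D /\ through_some D)].

Definition alpha : int :=
  least 0 [set dot (strict_cls D) (strict_cls D) | D in curvesS].

Definition beta : int :=
  least 0 [set dot (exc_cls i) (exc_cls i) | i in setT].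

Section Values.
Variable R : realType.

(* The cone of (x, y, m) attached to a ruling, given by its set of fibers, and *)
(* to a curve S in the role of the special section.                            *)
Definition in_cone (fibers : set (effdiv k delta)) (S : effdiv k delta)
    (x y : R) (m : 'I_N -> R) : Prop :=
  [/\ forall i, \sum_(j < N | proximate p j i) m j <= m i,
      forall F, fibers F -> (exists i, proper (p i) /\ through F (p i)) ->
        \sum_(i < N | through F (p i)) m i <= y
    & \sum_(i < N | through S (p i)) m i <= x].

Definition cone_value (fibers : set (effdiv k delta)) (S : effdiv k delta) : nat :=
  least 0%N [set t | (0 < t)%N /\
    forall x y m, in_cone fibers S x y m ->
      0 <= 2 * x * y + t%:R * y ^+ 2 - \sum_(i < N) m i ^+ 2].

Definition aval : nat := cone_value (@linsysF k delta) (M0 k delta).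

(* a1val and a2val are meant for delta = 0 only; in a2val the rulings are      *)
(* exchanged, so the coordinates x, y of in_cone are the paper's y, x.         *)
Definition a1val : nat :=
  least 0%N [set cone_value (@linsysF k delta) S | S in @linsysM k delta].

Definition a2val : nat :=
  least 0%N [set cone_value (@linsysM k delta) S | S in @linsysF k delta].

Definition omega : int :=
  if delta == 0%N then (maxn a1val a2val)%:Z else aval%:Z - delta%:Z.

End Values.
End BlownUpSurface.

(* Main.v *)
Require Import Defs.
From HB Require Import structures.
From mathcomp Require Import all_boot all_order all_algebra.
From mathcomp Require Import mpoly.
From mathcomp Require Import boolp classical_sets reals.
From mathcomp Require Import zify ring.

(* Bezout's theorem shows that the class (x, y, m) of an integral curve lies in
   the cone defining the value a, unless the curve is one of the lines (fibers
   or special section) that cut out this cone; the inequality defining a is then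
   a lower bound for C^2 = 2xy + delta y^2 - sum_i m_i^2.  The lines themselves
   are either in S or of self-intersection 0, and the exceptional curves are
   covered by beta, resp. have H^* . C = 0.
     Every intersection number involved is the order of vanishing of a
   univariate polynomial.  A line of the surface, or an exceptional curve, is a
   coordinate line in each of the local charts, and it meets the next
   exceptional curve in one point only, which is the origin of a chart.
   Restricting a local equation to the line and blowing up at that point divides
   the restriction by X^m, where m is the multiplicity; hence the sum of the
   multiplicities at the infinitely near points of the line is at most the order
   of the restriction.  On the whole line, these orders are those of the zeros
   of a binary form on P^1, so they add up to at most its degree. *)

Import Order.TTheory GRing.Theory Num.Theory.
Local Open Scope ring_scope.

Set Implicit Arguments.
Unset Strict Implicit.
Unset Printing Implicit Defensive.

(* ssrnat and mxpoly shadow these names. *)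
Local Notation eqn := Defs.eqn.
Local Notation integral_div := Defs.integral_div.

(** Each selected point is labelled by a chain and a position in it. Injectivity of [p] makes the
    labels distinct, so the sum is part of a sum over a finite rectangle of labels, where the last
    hypothesis applies. *)
Lemma leq_sum_chains (N : nat) (T D : eqType) (p : 'I_N -> T) (J : pred 'I_N)
    (mu : T -> nat) (e : D -> nat -> T) (n : nat) :
  injective p ->
  (forall i, J i -> exists d j, p i = e d j) ->
  (forall (s : seq D) B, uniq s ->
     (\sum_(d <- s) \sum_(j < B) mu (e d j) <= n)%N) ->
  (\sum_(i | J i) mu (p i) <= n)%N.
Proof.
move=> p_inj Je le_n.
case: (pickP J) => [i0 Ji0|J0]; last by rewrite big_pred0.
have [d0 _] := Je _ Ji0.
have /choice[g gP] (i : 'I_N) : exists dj : D * nat, J i -> p i = e dj.1 dj.2.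
  by have [/Je[d [j ->]]|] := boolP (J i); [exists (d, j) | exists (d0, 0%N)].
set r := [seq g i | i <- enum J].
have r_uniq : uniq r.
  rewrite map_inj_in_uniq ?enum_uniq// => i j; rewrite !mem_enum => Ji Jj eq_g.
  by apply: p_inj; rewrite (gP _ Ji) (gP _ Jj) eq_g.
have -> : (\sum_(i | J i) mu (p i) = \sum_(x <- r) mu (e x.1 x.2))%N.
  by rewrite big_map big_enum; apply: eq_bigr => i /gP ->.
set s := undup [seq x.1 | x <- r].
have [B ltB] : exists B, forall x, x \in r -> (x.2 < B)%N.
  exists (\max_(x <- r) x.2).+1 => x xr; rewrite ltnS.
  exact: (@leq_bigmax_seq _ _ xpredT (fun x : D * nat => x.2)).
apply: leq_trans (le_n s B (undup_uniq _)).
rewrite (eq_bigr (fun d => \sum_(j <- iota 0 B) mu (e d j)))%N; last first.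
  by move=> d _; rewrite -(big_mkord xpredT (fun j => mu (e d j))) /index_iota subn0.
rewrite -(big_allpairs (F := fun x : D * nat => mu (e x.1 x.2))) /=.
apply: (@uniq_sub_le_big _ _ leq leqnn (fun x y => leq_addr y x)) => //.
  by rewrite allpairs_uniq ?undup_uniq ?iota_uniq// => -[? ?] [? ?] _ _ [-> ->].
move=> -[d j] dj_r; apply/allpairsP; exists (d, j); split=> //.
  by rewrite mem_undup; apply/mapP; exists (d, j).
by rewrite mem_iota /= add0n; apply: (ltB _ dj_r).
Qed.

(** * Zeros of binary forms on the projective line *)

Section PolynomialsOnP1.
Variable k : closedFieldType.

(** Homogeneous coordinates near [d], with local parameter ['X] vanishing at [d]; this is
    [local_coords] in one variable. *)
Definition chart (d : P1 k) : {poly k} * {poly k} :=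
  if d is Some a then (1, a%:P + 'X) else ('X, 1).

(** [P] stands for a binary form dehomogenized by setting the first variable to 1. Its degree [n]
    has to be given, since a zero at infinity lowers the size of [P]. *)
Definition binform n (P : {poly k}) (A : {poly k} * {poly k}) : {poly k} :=
  \sum_(i < n.+1) P`_i *: (A.1 ^+ (n - i) * A.2 ^+ i).

Lemma binformE n A (T : eqType) (r : seq T) (c : T -> k) (ea eb : T -> nat) :
  {in r, forall m, c m != 0 -> (ea m + eb m = n)%N} ->
  binform n (\sum_(m <- r) c m *: 'X^(eb m)) A
  = \sum_(m <- r) c m *: (A.1 ^+ ea m * A.2 ^+ eb m).
Proof.
move=> ab_n; rewrite /binform.
under eq_bigr do rewrite coef_sum scaler_suml.
rewrite exchange_big /=; apply: eq_big_seq => m /ab_n.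
have [->|c0 /(_ isT) abn] := eqVneq (c m) 0.
  by move=> _; rewrite !scale0r big1 // => i _; rewrite coef0 scale0r.
have ltb : (eb m < n.+1)%N by rewrite ltnS -abn leq_addl.
rewrite (bigD1 (Ordinal ltb)) //= coefZ coefXn eqxx mulr1 -{1}abn addnK.
by rewrite big1 ?addr0// => i /negPf; rewrite -val_eqE /= coefZ coefXn => ->;
  rewrite mulr0 scale0r.
Qed.

Lemma binform_Some n (P : {poly k}) a : (size P <= n.+1)%N ->
  binform n P (chart (Some a)) = P \Po ('X + a%:P).
Proof.
move=> szP; rewrite comp_polyE (big_ord_widen _ (fun i => P`_i *: ('X + a%:P) ^+ i) szP).
rewrite big_mkcond; apply: eq_bigr => i _ /=.
case: ltnP => [_|le_i]; first by rewrite expr1n mul1r addrC.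
by rewrite nth_default// scale0r.
Qed.

Lemma coef_binform_None n (P : {poly k}) i : (i <= n)%N ->
  (binform n P (chart None))`_i = P`_(n - i).
Proof.
move=> le_in; rewrite coef_sum.
have lt_ni : (n - i < n.+1)%N by rewrite ltnS leq_subr.
rewrite (bigD1 (Ordinal lt_ni)) //= expr1n mulr1 coefZ coefXn subKn// eqxx mulr1.
rewrite big1 ?addr0// => j; rewrite -val_eqE /= => ne_j.
rewrite expr1n mulr1 coefZ coefXn; case: eqP => [ij|]; last by rewrite mulr0.
by case/eqP: ne_j; rewrite ij subKn// -ltnS.
Qed.

Lemma sum_root_mult (s : seq k) (e : k -> nat) (P : {poly k}) : P != 0 -> uniq s ->
  {in s, forall a, ('X - a%:P) ^+ e a %| P} -> (\sum_(a <- s) e a < size P)%N.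
Proof.
elim: s P => [|a s IHs] P P0; first by rewrite big_nil size_poly_gt0.
move=> /andP[as_ us] dvdP.
have /dvdpP[Q defP] := dvdP a (mem_head _ _).
have Q0 : Q != 0 by apply: contraNneq P0 => Q0; rewrite defP Q0 mul0r.
have ltQ : (\sum_(b <- s) e b < size Q)%N.
  apply: IHs => // b bs; have := dvdP b; rewrite inE bs orbT => /(_ isT).
  rewrite defP mulrC Gauss_dvdpr// coprimep_expl// coprimep_expr//.
  rewrite coprimep_XsubC root_XsubC.
  by apply: contraNneq as_ => ->.
rewrite big_cons defP size_Mmonic ?monic_exp ?monicXsubC// size_exp_XsubC.
by rewrite addnS /= addnC ltn_add2r.
Qed.

(** At finite points the form is a translate of [P], whose roots number at most its degree. At
    infinity the coefficients are reversed, so the order there is at most [n] minus that degree. *)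
Lemma bezout_P1 n (P : {poly k}) (s : seq (P1 k)) (e : P1 k -> nat) :
  P != 0 -> (size P <= n.+1)%N -> uniq s ->
  {in s, forall d, 'X^(e d) %| binform n P (chart d)} -> (\sum_(d <- s) e d <= n)%N.
Proof.
move=> P0 szP us dvd_e.
have le_Some : (\sum_(a <- pmap id s) e (Some a) < size P)%N.
  apply: sum_root_mult => //; first by rewrite (pmap_uniq (g := Some))//; case.
  move=> a; rewrite -[in X in X -> _](@mem_map _ _ _ Some_inj).
  rewrite mem_map; last exact: Some_inj.
  rewrite mem_pmap map_id => /dvd_e; rewrite binform_Some// => /dvdpP[Q defP].
  apply/dvdpP; exists (Q \Po ('X - a%:P)).
  rewrite -[P]comp_polyXr -[in LHS](subrK a%:P 'X).
  rewrite -[X in P \Po (_ + X)](comp_polyC _ ('X - a%:P)).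
  rewrite -[X in P \Po (X + _)](comp_polyX ('X - a%:P)) -comp_polyD.
  by rewrite comp_polyA defP comp_polyM rmorphXn /= comp_polyX.
have le_None : None \in s -> (e None <= n - (size P).-1)%N.
  move=> /dvd_e/dvdpP[Q defP]; rewrite leqNgt; apply/negP => lt_e.
  have := coef_binform_None P (leq_subr (size P).-1 n).
  rewrite defP coefMXn lt_e subKn; last by rewrite -ltnS prednK ?size_poly_gt0.
  by move/esym/eqP; rewrite -lead_coefE lead_coef_eq0 (negPf P0).
have -> : (\sum_(d <- s) e d
          = (None \in s) * e None + \sum_(a <- pmap id s) e (Some a))%N.
  elim: s us {dvd_e le_Some le_None} => [|[a|] s IHs]; first by rewrite !big_nil.
    by move=> /andP[_ us]; rewrite in_cons /= !big_cons IHs// addnCA.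
  by move=> /andP[/negPf Ns us]; rewrite in_cons /= !big_cons IHs// Ns mul0n add0n mul1n.
have := size_poly_gt0 P; rewrite P0.
by case: (_ \in _) le_None => [/(_ isT)|_]; lia.
Qed.

End PolynomialsOnP1.

(** * Strict transforms in local charts, coordinate lines and exceptional divisors *)

Section StrictTransforms.
Variable k : closedFieldType.
Implicit Types (f g : {mpoly k[2]}) (d : P1 k) (sw : bool).

Local Notation o0 := (@Ordinal 2 0 isT).
Local Notation o1 := (@Ordinal 2 1 isT).

Lemma mdeg2 (m : 'X_{1..2}) : mdeg m = (m o0 + m o1)%N.
Proof.
rewrite mdegE !big_ord_recl big_ord0 addn0.
by congr (m _ + m _)%N; apply: val_inj.
Qed.

Lemma vorder_le f m : m \in msupp f -> (vorder f <= mdeg m)%N.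
Proof.
rewrite /vorder; elim: (msupp f) => // m' s IHs; rewrite inE big_cons.
by case/predU1P=> [->|/IHs]; [exact: geq_minl | apply: leq_trans; exact: geq_minr].
Qed.

Lemma vorder_attained f : f != 0 -> exists2 m, m \in msupp f & mdeg m = vorder f.
Proof.
(* The initial value [msize f] of the minimum exceeds the degree of every monomial, so the first
   alternative is refuted by the leading monomial. *)
move=> f0; have : vorder f = msize f \/ exists2 m, m \in msupp f & mdeg m = vorder f.
  rewrite /vorder; elim: (msupp f) => [|m s IHs]; first by left; rewrite big_nil.
  rewrite big_cons /minn; case: ltnP => _.
    by right; exists m; rewrite ?mem_head.
  by case: IHs => [|[m' m's <-]]; [left | right; exists m'; rewrite // inE m's orbT].
case=> // vf; have := vorder_le (mlead_supp f0).
by rewrite vf -mlead_deg// ltnn.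
Qed.

Lemma vorder0 : vorder (0 : {mpoly k[2]}) = 0%N.
Proof. by rewrite /vorder msupp0 big_nil msize0. Qed.

Lemma vorder_eq0 f : f@_0%MM != 0 -> vorder f = 0%N.
Proof.
by rewrite -mcoeff_msupp => /vorder_le; rewrite mdeg0 leqn0 => /eqP.
Qed.

Lemma strict_tr0 d : strict_tr d 0 = 0 :> {mpoly k[2]}.
Proof. by rewrite /strict_tr msupp0 big_nil. Qed.

Lemma vorderZ (c : k) f : c != 0 -> vorder (c *: f) = vorder f.
Proof.
move=> c0; have [->|f0] := eqVneq f 0; first by rewrite scaler0.
have cf0 : c *: f != 0 by rewrite scaler_eq0 negb_or c0.
have supp_cf := perm_mem (msuppZ f c0); apply/eqP; rewrite eqn_leq; apply/andP; split.
  by have [m mf <-] := vorder_attained f0; apply: vorder_le; rewrite supp_cf.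
by have [m mf <-] := vorder_attained cf0; apply: vorder_le; rewrite -supp_cf.
Qed.

Lemma strict_trZ (c : k) d f : c != 0 -> strict_tr d (c *: f) = c *: strict_tr d f.
Proof.
move=> c0; rewrite /strict_tr vorderZ// scaler_sumr.
rewrite [LHS](perm_big (msupp f)); last exact: msuppZ.
by apply: eq_bigr => m _; rewrite mcoeffZ scalerA.
Qed.

Lemma local_eqZ (c : k) (F : {mpoly k[4]}) q : c != 0 ->
  local_eq (c *: F) q = c *: local_eq F q.
Proof.
case: q => o ds c0; rewrite /local_eq /=; elim: ds => [|d ds /= ->].
  by rewrite /= /local_eq0 comp_mpolyZ.
by rewrite strict_trZ.
Qed.

Lemma local_eq_nseq (F : {mpoly k[4]}) o j d ds :
  local_eq F (o, nseq j d ++ ds) = iter j (strict_tr d) (local_eq F (o, ds)).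
Proof. by rewrite /local_eq /=; elim: j => //= j ->. Qed.

(* The coordinate lines: [restr sw] restricts to [lineq sw = 0], which for
   [sw = false] (resp. [true]) is U = 0 (resp. V = 0); on every blowup, the
   strict transform of that line passes through the point [tangent sw] only. *)
Definition lineq sw : {mpoly k[2]} := if sw then V k else U k.

Definition tangent sw : P1 k := if sw then Some 0 else None.

Definition restr sw (f : {mpoly k[2]}) : {poly k} :=
  mmap (@polyC k) (fun i : 'I_2 => if (i == o0) == sw then 'X else 0) f.

Lemma restrZ sw c f : restr sw (c *: f) = c *: restr sw f.
Proof. by rewrite /restr mmapZ mul_polyC. Qed.

Lemma restrM sw : {morph restr sw : f g / f * g}.
Proof. exact: rmorphM. Qed.

Lemma restrXn sw f n : restr sw (f ^+ n) = restr sw f ^+ n.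
Proof. exact: rmorphXn. Qed.

Lemma restr_sum sw (I : Type) (r : seq I) (F : I -> {mpoly k[2]}) :
  restr sw (\sum_(i <- r) F i) = \sum_(i <- r) restr sw (F i).
Proof. exact: raddf_sum. Qed.

Lemma restrU sw : restr sw (U k) = if sw then 'X else 0.
Proof. by rewrite /restr /U mmapX mmap1U; case: sw. Qed.

Lemma restrV sw : restr sw (V k) = if sw then 0 else 'X.
Proof. by rewrite /restr /V mmapX mmap1U; case: sw. Qed.

Lemma restrDC sw f c : restr sw (f + c%:MP) = restr sw f + c%:P.
Proof. by rewrite /restr mmapD mmapC. Qed.

Definition restrE := (restrZ, restrM, restrXn, restrU, restrV, restrDC).

Lemma restr_msupp sw f : restr sw f =
  \sum_(m <- msupp f) f@_m *: (restr sw (U k) ^+ m o0 * restr sw (V k) ^+ m o1).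
Proof.
rewrite {1}[f]mpolyE restr_sum; apply: eq_bigr => m _.
rewrite restrZ -!restrXn -restrM mpolyXE_id !big_ord_recl big_ord0 mulr1.
by congr (_ *: restr _ ('X_ _ ^+ m _ * 'X_ _ ^+ m _)); apply: val_inj.
Qed.

(** Monomials divisible by the equation of the line restrict to 0 on both sides. The others are
    powers of the remaining coordinate, which the strict transform divides by its power of exponent
    [vorder f]. *)
Lemma restr_tangent sw f :
  'X^(vorder f) * restr sw (strict_tr (tangent sw) f) = restr sw f.
Proof.
rewrite [RHS]restr_msupp /strict_tr restr_sum mulr_sumr; apply: eq_big_seq => m mf.
have := vorder_le mf; rewrite mdeg2 => le_m.
rewrite !restrE -scalerAr; congr (_ *: _).
case: sw; rewrite /= !restrE /= ?addr0.
- case: (m o1) le_m => [|n] le_m; last by rewrite !exprS !mul0r !mulr0.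
  by rewrite !expr0 !mulr1 -exprD subnKC // addn0.
- case: (m o0) le_m => [|n] le_m; last by rewrite !exprS !mul0r !mulr0.
  by rewrite !expr0 !mul1r -exprD subnKC.
Qed.

Lemma chain_dvd sw f B :
  'X^(\sum_(j < B) vorder (iter j (strict_tr (tangent sw)) f)) %| restr sw f.
Proof.
elim: B f => [|B IHB] f; first by rewrite big_ord0 dvd1p.
rewrite big_ord_recl exprD -[restr sw f]restr_tangent dvdp_mul2l ?monic_neq0 ?monicXn//.
apply: dvdp_trans (IHB (strict_tr (tangent sw) f)).
rewrite [X in 'X^X %| _](eq_bigr (fun j : 'I_B =>
  vorder (iter j (strict_tr (tangent sw)) (strict_tr (tangent sw) f)))) //.
by move=> j _; rewrite -iterSr.
Qed.

(** The tangent cone, a binary form of degree [vorder f], dehomogenized by [U = 1]. *)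
Definition lead_form (f : {mpoly k[2]}) : {poly k} :=
  \sum_(m <- msupp f | mdeg m == vorder f) f@_m *: 'X^(m o1).

(** In a fixed total degree the exponent of [V] determines the monomial, so no coefficients
    cancel. *)
Lemma lead_form_neq0 f : f != 0 -> lead_form f != 0.
Proof.
case/vorder_attained => m mf vm; apply/negP => /eqP/(congr1 (fun P : {poly k} => P`_(m o1))).
rewrite coef0 coef_sum (big_rem m)//= vm eqxx coefZ coefXn eqxx mulr1 big_seq_cond big1 ?addr0.
  by apply/eqP; rewrite -mcoeff_msupp.
move=> m' /andP[]; rewrite mem_rem_uniq ?msupp_uniq// inE => /andP[/eqP ne_m _].
rewrite -vm !mdeg2 coefZ coefXn => /eqP deg_m'.
case: eqP => [eq1|_]; last by rewrite mulr0.
case: ne_m; apply/mnmP => i; have [->|->] : i = o0 \/ i = o1.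
- by case: i => -[|[|//]] ?; [left | right]; apply: val_inj.
- by move: deg_m'; rewrite eq1 => /addIn.
- by [].
Qed.

Lemma size_lead_form f : (size (lead_form f) <= (vorder f).+1)%N.
Proof.
apply: (leq_trans (size_sum _ _ _)); apply/bigmax_leqP_seq => m _ /eqP <-.
by apply: leq_trans (size_scale_leq _ _) _; rewrite size_polyXn mdeg2 ltnS leq_addl.
Qed.

(** Here [d] is coerced to a boolean, and [~~ d] is the index of the coordinate line that is the
    exceptional divisor in the chart at [d]. Terms of degree above [vorder f] keep a factor
    vanishing on it, so only the tangent cone survives. *)
Lemma restr_strict_tr d f :
  restr (~~ d) (strict_tr d f) = binform (vorder f) (lead_form f) (chart d).
Proof.
rewrite /lead_form -big_filter (@binformE _ _ _ _ _ _ (fun m : 'X_{1..2} => m o0)); last first.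
  by move=> m; rewrite mem_filter mdeg2 => /andP[/eqP].
rewrite big_filter big_mkcond /strict_tr restr_sum; apply: eq_big_seq => m /vorder_le.
rewrite restrZ leq_eqVlt eq_sym; case: eqP => [-> _|_ /= lt_m]; last first.
  rewrite -(subnSK lt_m); case: d => [a|]; rewrite !restrE ?exprS /=.
    by rewrite mul0r mul0r scaler0.
  by rewrite mul0r mulr0 scaler0.
by rewrite subnn; case: d => [a|]; rewrite !restrE /= !expr0 ?expr1n ?mulr1 ?mul1r// addrC.
Qed.

(** The restrictions to the exceptional divisor all come from one binary form of degree [vorder f],
    to which [bezout_P1] applies once [f] is nonzero. *)
Lemma exceptional_bezout f (s : seq (P1 k)) B : uniq s ->
  (\sum_(d <- s) \sum_(j < B) vorder (iter j (strict_tr (tangent (~~ d))) (strict_tr d f))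
     <= vorder f)%N.
Proof.
move=> us; have [->|f0] := eqVneq f 0.
  rewrite big1 // => d _; rewrite big1// => j _; rewrite strict_tr0.
  by rewrite iter_fix ?strict_tr0// vorder0.
apply: (bezout_P1 (lead_form_neq0 f0) (size_lead_form f) us) => d _.
by rewrite -restr_strict_tr chain_dvd.
Qed.

Lemma vorder_strict_tr d f : (vorder (strict_tr d f) <= vorder f)%N.
Proof.
by have := @exceptional_bezout f [:: d] 1 isT; rewrite big_seq1 big_ord1.
Qed.

Lemma vorderX (m : 'X_{1..2}) : vorder ('X_[m] : {mpoly k[2]}) = mdeg m.
Proof. by rewrite /vorder msuppX big_cons big_nil msizeX; apply/minn_idPl. Qed.

Lemma strict_trX d (m : 'X_{1..2}) :
  strict_tr d 'X_[m] = if d is Some a then (V k + a%:MP) ^+ m o1 else U k ^+ m o0.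
Proof.
rewrite /strict_tr msuppX big_seq1 mcoeffX eqxx scale1r vorderX subnn !expr0.
by case: d => [a|]; rewrite ?mul1r ?mulr1.
Qed.

Lemma vorder_lineq sw : vorder (lineq sw) = 1%N.
Proof.
by rewrite /lineq /U /V; case: sw; rewrite vorderX mdeg1.
Qed.

Lemma strict_tr_lineq sw d :
  d = tangent sw /\ strict_tr d (lineq sw) = lineq sw
  \/ vorder (strict_tr d (lineq sw)) = 0%N.
Proof.
rewrite /lineq; case: sw; rewrite /U /V strict_trX; case: d => [a|];
  rewrite ?mnm1E ?expr0 ?expr1.
- have [->|a0] := eqVneq a 0; first by left; rewrite addr0.
  right; apply: vorder_eq0; rewrite mcoeffD mcoeffX mnm1_eq0 mcoeffC eqxx mulr1 add0r//.
- by right; apply: vorder_eq0; rewrite mcoeff1 eqxx oner_eq0.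
- by right; apply: vorder_eq0; rewrite mcoeff1 eqxx oner_eq0.
- by left.
Qed.

(** The strict transform of an exceptional divisor starts as a coordinate line. A later blown-up
    direction either follows it, leaving its equation unchanged, or leaves it, and then the equation
    never vanishes again. The induction therefore carries the local equation along. *)
Lemma on_exc_chain (q r : ipoint k) : on_exc q r ->
  exists d j, r = (q.1, nseq j (tangent (~~ d)) ++ d :: q.2).
Proof.
case: r => o ds; rewrite /on_exc /=.
suff : vorder (exc_local_eq q o ds) = 0%N \/ exists d j,
    (o, ds) = (q.1, nseq j (tangent (~~ d)) ++ d :: q.2)
    /\ exc_local_eq q o ds = lineq (~~ d).
  by case=> [->//|[d [j [-> _]]] _]; exists d, j.
elim: ds => [|d ds IHds] /=.
  by left; apply: vorder_eq0; rewrite mcoeff1 eqxx oner_eq0.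
case: eqP => [<-|_]; first by right; exists d, 0%N; case: d.
case: IHds => [v0|[d' [j [[-> ->] ->]]]].
  by left; apply/eqP; rewrite -leqn0 -v0 vorder_strict_tr.
case: (strict_tr_lineq (~~ d') d) => [[-> ->]|]; last by left.
by right; exists d', j.+1.
Qed.

Lemma on_exc_cons o d ds : on_exc (o, ds) (o, d :: ds).
Proof.
rewrite /on_exc /= eqxx; have := vorder_lineq (~~ d).
by case: d => [a|] /= ->.
Qed.

End StrictTransforms.

(** * Substitutions in polynomials *)

(** The linear map sending ['X^j] to [Y j] kills 0. This lifts the vanishing of a restriction to a
    line back to the homogeneous coordinates. *)
Lemma scale_sum_eq0 (K : fieldType) (W : lmodType K) (T : Type) (r : seq T)
    (c : T -> K) (e : T -> nat) (Y : nat -> W) :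
  \sum_(m <- r) c m *: 'X^(e m) = 0 -> \sum_(m <- r) c m *: Y (e m) = 0.
Proof.
move=> sum0.
have [B ltB] : exists B, all (fun m => (e m < B)%N) r.
  exists (\max_(m <- r) e m).+1; elim: r {sum0} => //= m r IHr.
  rewrite big_cons ltnS leq_maxl /=; apply: sub_all IHr => m' /leq_trans -> //.
  by rewrite ltnS leq_maxr.
have YE j : (j < B)%N -> Y j = \sum_(i < B) ('X^j : {poly K})`_i *: Y i.
  move=> ltj; rewrite (bigD1 (Ordinal ltj)) //= coefXn eqxx scale1r big1 ?addr0// => i.
  by rewrite -val_eqE /= coefXn => /negPf ->; rewrite scale0r.
have -> : \sum_(m <- r) c m *: Y (e m)
        = \sum_(m <- r) \sum_(i < B) (c m *: 'X^(e m))`_i *: Y i.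
  elim: r ltB {sum0} => [|m r IHr]; first by rewrite !big_nil.
  case/andP=> lt_m /IHr {}IHr; rewrite !big_cons IHr (YE _ lt_m) scaler_sumr.
  by congr (_ + _); apply: eq_bigr => i _; rewrite coefZ scalerA.
rewrite exchange_big big1 //= => i _; rewrite -scaler_suml -coef_sum sum0.
by rewrite coef0 scale0r.
Qed.

Lemma mPo_congr (K : fieldType) n (l : {mpoly K[n]}) (q : n.-tuple {mpoly K[n]}) :
  (forall i, exists h, 'X_i - tnth q i = l * h) ->
  forall f, exists h, f - (f \mPo q) = l * h.
Proof.
move=> q_congr f; rewrite comp_mpolyE {1}[f]mpolyE -sumrB.
apply: (big_ind (fun a => exists h, a = l * h)).
- by exists 0; rewrite mulr0.
- by move=> _ _ [h ->] [h' ->]; exists (h + h'); rewrite mulrDr.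
move=> m _; rewrite -scalerBr mpolyXE_id.
suff [h ->] : exists h, \prod_(i < n) 'X_i ^+ m i - \prod_(i < n) tnth q i ^+ m i = l * h.
  by exists (f@_m *: h); rewrite scalerAr.
have mul_congr a a' b b' : (exists h, a - a' = l * h) -> (exists h, b - b' = l * h) ->
    exists h, a * b - a' * b' = l * h.
  move=> [h ah] [h' bh]; exists (h * b + a' * h').
  by rewrite mulrDr mulrA -ah mulrCA -bh; ring.
apply: (big_ind2 (fun a b => exists h, a - b = l * h)) => //.
  by exists 0; rewrite subrr mulr0.
move=> i _; elim: (m i) => [|e IHe]; first by exists 0; rewrite !expr0 subrr mulr0.
by rewrite !exprS; apply: mul_congr.
Qed.

(** * Fibers and sections as lines: local equations, restriction, divisibility *)

Section Lines.
Variable k : closedFieldType.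
Implicit Types (f : {mpoly k[4]}) (t d : P1 k) (sw : bool).

Definition coordP1 t : k * k := if t is Some a then (1, a) else (0, 1).

Definition lvar sw : 'I_4 * 'I_4 := if sw then (iu0, iu1) else (is0, is1).

(* The fiber over [t] if [sw = false]; the section [u0 : u1] = [t] if
   [sw = true], which is well defined if delta = 0, or if [t = None], and then
   it is M_0. *)
Definition lin sw t : {mpoly k[4]} :=
  if t is Some a then 'X_(lvar sw).2 - a *: 'X_(lvar sw).1 else 'X_(lvar sw).1.

Lemma ord4_lvar sw (i : 'I_4) : [\/ i = (lvar sw).1, i = (lvar sw).2,
  i = (lvar (~~ sw)).1 | i = (lvar (~~ sw)).2].
Proof.
case: i => -[|[|[|[|//]]]] ?; case: sw;
  by [constructor 1; exact: val_inj | constructor 2; exact: val_inj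
     |constructor 3; exact: val_inj | constructor 4; exact: val_inj].
Qed.

(** The point with parameter [d] on the line [lin sw t]. *)
Definition pt sw t d : P1 k * P1 k := if sw then (d, t) else (t, d).

Lemma lin_mcoeff sw t (i := if t is Some _ then (lvar sw).2 else (lvar sw).1) :
  (lin sw t)@_U_(i) = 1.
Proof.
rewrite {}/i /lin; case: t => [a|]; rewrite ?mcoeffB ?mcoeffZ !mcoeffXU eqxx//.
by case: sw; rewrite /= mulr0 subr0.
Qed.

Lemma lin_neq0 sw t : lin sw t != 0.
Proof.
apply: contra_eq_neq (lin_mcoeff sw t) => ->.
by rewrite mcoeff0 eq_sym oner_eq0.
Qed.

Lemma msupp_lin sw t m : m \in msupp (lin sw t) ->
  m = U_((lvar sw).1)%MM \/ m = U_((lvar sw).2)%MM.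
Proof.
rewrite /lin; case: t => [a|]; last by rewrite msuppX inE => /eqP ->; left.
move=> /msuppB_le; rewrite mem_cat => /orP[|/msuppZ_le]; rewrite msuppX inE => /eqP ->;
  by [left | right].
Qed.

Lemma msize_lin sw t : msize (lin sw t) = 2%N.
Proof.
rewrite -mlead_deg ?lin_neq0//; have := mlead_supp (lin_neq0 sw t).
by case/msupp_lin=> ->; rewrite mdeg1.
Qed.

Lemma linP f sw : f != 0 ->
  (forall m, m \in msupp f -> m = U_((lvar sw).1)%MM \/ m = U_((lvar sw).2)%MM) ->
  exists c t, c != 0 /\ f = c *: lin sw t.
Proof.
move=> f0 supp_f; set i0 := (lvar sw).1; set i1 := (lvar sw).2.
have i01 : i0 != i1 by rewrite /i0 /i1; case: sw {supp_f i0 i1}.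
have fE : f = f@_U_(i0) *: 'X_i0 + f@_U_(i1) *: 'X_i1.
  apply/mpolyP => m; rewrite mcoeffD !mcoeffZ !mcoeffX.
  have [/supp_f[->|->]|m_f] := boolP (m \in msupp f).
  - by rewrite eqxx mulr1 eq_mnm1 eq_sym (negPf i01) mulr0 addr0.
  - by rewrite eqxx mulr1 eq_mnm1 (negPf i01) mulr0 add0r.
  rewrite (memN_msupp_eq0 m_f).
  by do 2!case: eqP => [->|_]; rewrite ?(memN_msupp_eq0 m_f) ?mul0r ?mulr0 ?addr0.
have [f1|f1] := eqVneq f@_U_(i1) 0.
  exists f@_U_(i0), None; split; last by rewrite [LHS]fE f1 scale0r addr0.
  by apply: contraNneq f0 => f00; rewrite fE f1 f00 !scale0r addr0.
exists f@_U_(i1), (Some (- (f@_U_(i0) / f@_U_(i1)))); split=> //.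
rewrite {1}fE /lin -/i0 -/i1 scalerBr scalerA mulrN mulrCA divff// mulr1.
by rewrite scaleNr opprK addrC.
Qed.

Lemma local_eq0_lin sw t o : o = pt sw t (if sw then o.1 else o.2) /\
    local_eq0 o (lin sw t) = lineq k sw
  \/ vorder (local_eq0 o (lin sw t)) = 0%N.
Proof.
case: o => b v; rewrite /local_eq0 /lin /lineq /pt.
case: sw; case: t => [a|]; rewrite /lvar ?comp_mpolyB ?comp_mpolyZ !comp_mpolyXU /=.
- case: v => [c|] /=.
    have [->|ca] := eqVneq c a; [left | right].
      by rewrite -mul_mpolyC mulr1 addrC addKr.
    apply: vorder_eq0; rewrite mcoeffB mcoeffD mcoeffZ mcoeffX mcoeffC mcoeff1.
    by rewrite mnm1_eq0 eqxx !mulr1 addr0 subr_eq0.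
  right; apply: vorder_eq0; rewrite mcoeffB mcoeffZ mcoeffX mcoeff1 mnm1_eq0 eqxx.
  by rewrite mulr0 subr0 oner_eq0.
- case: v => [c|] /=; last by left.
  by right; apply: vorder_eq0; rewrite mcoeff1 eqxx oner_eq0.
- case: b => [c|] /=.
    have [->|ca] := eqVneq c a; [left | right].
      by rewrite -mul_mpolyC mulr1 addrC addKr.
    apply: vorder_eq0; rewrite mcoeffB mcoeffD mcoeffZ mcoeffX mcoeffC mcoeff1.
    by rewrite mnm1_eq0 eqxx !mulr1 addr0 subr_eq0.
  right; apply: vorder_eq0; rewrite mcoeffB mcoeffZ mcoeffX mcoeff1 mnm1_eq0 eqxx.
  by rewrite mulr0 subr0 oner_eq0.
- case: b => [c|] /=; last by left.
  by right; apply: vorder_eq0; rewrite mcoeff1 eqxx oner_eq0.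
Qed.

Lemma local_eq0_lin_pt sw t d : local_eq0 (pt sw t d) (lin sw t) = lineq k sw.
Proof.
rewrite /local_eq0 /lin /lineq /pt.
case: sw; case: t => [a|]; rewrite /lvar ?comp_mpolyB ?comp_mpolyZ !comp_mpolyXU //=;
  by rewrite -mul_mpolyC mulr1 addrC addKr.
Qed.

(** The analogue of [on_exc_chain] for a line of the surface, by the same dichotomy. *)
Lemma local_eq_lin sw t q :
  (exists d j, q = (pt sw t d, nseq j (tangent k sw)))
    /\ local_eq (lin sw t) q = lineq k sw
  \/ vorder (local_eq (lin sw t) q) = 0%N.
Proof.
case: q => o ds; rewrite /local_eq /=; elim: ds => [|d ds IHds].
  case: (local_eq0_lin sw t o) => [[o_t eq_t]|]; last by right.
  by left; split=> //; exists (if sw then o.1 else o.2), 0%N; rewrite -o_t.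
case: IHds => [[[d' [j [-> ->]]] /= ->]|v0].
  case: (strict_tr_lineq sw d) => [[-> ->]|]; last by right.
  by left; split=> //; exists d', j.+1.
by right; apply/eqP; rewrite -leqn0 -[X in (_ <= X)%N]v0; exact: vorder_strict_tr.
Qed.

Lemma restr_local_coords t (i : bool) :
  restr (~~ i) (local_coords t (lineq k i)).1 = (chart t).1
  /\ restr (~~ i) (local_coords t (lineq k i)).2 = (chart t).2
  /\ restr i (local_coords t (lineq k i)).1 = (coordP1 t).1%:P
  /\ restr i (local_coords t (lineq k i)).2 = (coordP1 t).2%:P.
Proof.
have restr1 i' : restr i' (1 : {mpoly k[2]}) = 1 by exact: rmorph1.
have restrC i' (c : k) : restr i' c%:MP = c%:P by rewrite /restr mmapC.
have restrD i' : {morph restr (k := k) i' : x y / x + y} by exact: rmorphD.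
rewrite /lineq; case: i; case: t => [a|] /=;
  by rewrite !(restrD, restrC, restrU, restrV, restr1) /= ?addr0 ?add0r.
Qed.

Definition lcoef sw t f (m : 'X_{1..4}) : k :=
  f@_m * ((coordP1 t).1 ^+ m (lvar sw).1 * (coordP1 t).2 ^+ m (lvar sw).2).

(** The binary form induced by [f] on the line, in the pair of variables of the other family, the
    first of which is set to 1. *)
Definition lrestr sw t f : {poly k} :=
  \sum_(m <- msupp f) lcoef sw t f m *: 'X^(m (lvar (~~ sw)).2).

Lemma prod4 (A : comRingType) (F : 'I_4 -> A) sw : \prod_i F i =
  F (lvar sw).1 * F (lvar sw).2 * (F (lvar (~~ sw)).1 * F (lvar (~~ sw)).2).
Proof.
rewrite !big_ord_recl big_ord0 mulr1 mulrA.
have -> : lift ord0 (lift ord0 (lift ord0 (ord0 : 'I_1))) = iu1 by exact: val_inj.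
have -> : lift ord0 (lift ord0 (ord0 : 'I_2)) = iu0 by exact: val_inj.
have -> : lift ord0 (ord0 : 'I_3) = is1 by exact: val_inj.
have -> : ord0 = is0 by exact: val_inj.
by case: sw => //=; rewrite mulrC.
Qed.

Lemma restr_local_eq0 sw t d f :
  restr sw (local_eq0 (pt sw t d) f) = \sum_(m <- msupp f) lcoef sw t f m *:
    ((chart d).1 ^+ m (lvar (~~ sw)).1 * (chart d).2 ^+ m (lvar (~~ sw)).2).
Proof.
rewrite /local_eq0 comp_mpolyE restr_sum; apply: eq_bigr => m _.
rewrite restrZ (prod4 _ sw) !restrM !restrXn /lcoef -scalerA; congr (_ *: _).
have [_ [_ [tE1 tE2]]] := restr_local_coords t sw.
have [dE1 [dE2 _]] := restr_local_coords d (~~ sw).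
rewrite -mul_polyC polyCM !rmorphXn /=.
by congr (_ * _ * (_ * _)); congr (_ ^+ _); move: tE1 tE2 dE1 dE2; case: (sw).
Qed.

(** Modulo the equation of the line, its two variables are [w] times the coordinates of [t]. After
    this substitution [q], homogeneity makes every term a multiple of a monomial [Y j], where [j] is
    the exponent recorded by [lrestr]; hence [f \mPo q] vanishes with [lrestr]. *)
Lemma lin_dvd sw t f n (E : nat -> nat) :
  (forall m, m \in msupp f -> lcoef sw t f m != 0 ->
     (m (lvar (~~ sw)).1 + m (lvar (~~ sw)).2 = n)%N
     /\ (m (lvar sw).1 + m (lvar sw).2 = E (m (lvar (~~ sw)).2))%N) ->
  lrestr sw t f = 0 -> exists h, f = lin sw t * h.
Proof.
move=> fE f0; set c := coordP1 t.
pose w : {mpoly k[4]} := if t is Some _ then 'X_(lvar sw).1 else 'X_(lvar sw).2.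
pose q : 4.-tuple {mpoly k[4]} :=
  if sw then [tuple 'X_is0; 'X_is1; c.1 *: w; c.2 *: w]
        else [tuple c.1 *: w; c.2 *: w; 'X_iu0; 'X_iu1].
have q1 : tnth q (lvar sw).1 = c.1 *: w by rewrite /q; case: (sw).
have q2 : tnth q (lvar sw).2 = c.2 *: w by rewrite /q; case: (sw).
have q3 : tnth q (lvar (~~ sw)).1 = 'X_(lvar (~~ sw)).1 by rewrite /q; case: (sw).
have q4 : tnth q (lvar (~~ sw)).2 = 'X_(lvar (~~ sw)).2 by rewrite /q; case: (sw).
have q_congr i : exists h, 'X_i - tnth q i = lin sw t * h.
  case: (ord4_lvar sw i) => ->; rewrite ?q1 ?q2 ?q3 ?q4; [| |by exists 0; rewrite subrr mulr0..].
    rewrite /c /w /lin; case: t {f0 fE c w q q1 q2 q3 q4} => [a|] /=.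
      by exists 0; rewrite scale1r subrr mulr0.
    by exists 1; rewrite scale0r subr0 mulr1.
  rewrite /c /w /lin; case: t {f0 fE c w q q1 q2 q3 q4} => [a|] /=.
    by exists 1; rewrite mulr1.
  by exists 0; rewrite scale1r subrr mulr0.
have [h fh] := mPo_congr q_congr f; exists h; rewrite -fh.
suff -> : f \mPo q = 0 by rewrite subr0.
rewrite comp_mpolyE.
pose Y j : {mpoly k[4]} :=
  w ^+ E j * ('X_(lvar (~~ sw)).1 ^+ (n - j) * 'X_(lvar (~~ sw)).2 ^+ j).
rewrite -[RHS](scale_sum_eq0 Y f0); apply: eq_big_seq => m mf.
rewrite (prod4 _ sw) q1 q2 q3 q4 !exprZn -scalerAl -scalerAr -!scalerAl !scalerA.
rewrite -/(lcoef sw t f m).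
have [->|c0] := eqVneq (lcoef sw t f m) 0; first by rewrite !scale0r.
by have [En Em] := fE _ mf c0; rewrite /Y -En addnK -Em exprD.
Qed.

Lemma unit_mpolyP (n : nat) (h : {mpoly k[n]}) : h \is a GRing.unit ->
  exists2 c, c != 0 & h = c%:MP.
Proof. by case/andP=> /eqP hE; rewrite unitfE => h0; exists (h@_0%MM). Qed.


(** * Bezout inequalities for lines and proximity inequalities *)

Section Divisors.
Variable delta : nat.
Implicit Types (D : effdiv k delta).

Lemma msize2_integral D : msize (eqn D) = 2%N -> integral_div D.
Proof.
move=> size2; split; first by apply/negP => /unit_mpolyP[c c0 Dc]; move: size2;
  rewrite Dc msizeC c0.
move=> g h Dgh; have := eqn_neq0 D; rewrite Dgh mulf_eq0 negb_or => /andP[g0 h0].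
have unit1 (f : {mpoly k[4]}) : f != 0 -> (msize f <= 1)%N -> f \is a GRing.unit.
  move=> f0 /msize1_polyC fE; apply/andP; split; first exact/eqP.
  by rewrite unitfE; apply: contra_neq f0 => f00; rewrite fE f00 mpolyC0.
move: size2; rewrite Dgh msizeM// => size2.
have [le1|] := leqP (msize g) 1; first by left; apply: unit1.
move=> lt1; right; apply: unit1 => //; rewrite leqNgt; apply/negP => lt1'.
by have := leq_add lt1 lt1'; rewrite -(ltn_predK (leq_trans lt1 (leq_addr _ _))) size2.
Qed.

(** The intersection number with [M_0] if [sw] holds, and with a fiber otherwise. *)
Definition deg (sw : bool) D : int := if sw then clsF D else clsM D.

(** If the restriction to the line vanishes, the equation of the line divides that of [D], and
    irreducibility makes them proportional. Otherwise the restriction is a nonzero binary form of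
    degree [deg sw D]. *)
Lemma line_bezout sw t D : (sw -> (t == None) || (delta == 0)%N) -> integral_div D ->
  (exists2 c, c != 0 & eqn D = c *: lin sw t) \/
  forall N (p : 'I_N -> ipoint k) (L : effdiv k delta) c, injective p ->
    c != 0 -> eqn L = c *: lin sw t ->
    \sum_(i < N | through L (p i)) (mult D (p i))%:Z <= deg sw D.
Proof.
move=> t_delta [_ irrD].
(* The sign of the degree is settled later, by a monomial surviving the restriction. [E j] is the
   exponent in the two variables of the line that the bidegree forces. *)
pose n := absz (deg sw D).
pose E j := if sw then absz (clsM D) else absz (clsF D + delta%:Z * (clsM D - j%:Z)).
have mE m : m \in msupp (eqn D) -> lcoef sw t (eqn D) m != 0 ->
    ((m (lvar (~~ sw)).1 + m (lvar (~~ sw)).2)%N%:Z = deg sw D)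
     /\ (m (lvar sw).1 + m (lvar sw).2 = E (m (lvar (~~ sw)).2))%N.
  move=> /eqn_bihom[dF dM]; rewrite /E /deg /lcoef; case: (sw) t_delta => /= [t_delta|_].
    rewrite mulf_eq0 !negb_or mulf_eq0 negb_or => /and3P[_ c1 _]; split; last by lia.
    (* For [t = None] only monomials free of [u0] survive, which removes the term in [delta]; in the
       other case [delta] is 0. *)
    rewrite -dF; case/orP: (t_delta isT) c1 => [/eqP->|/eqP->] /=; last by lia.
    by rewrite expr0n; case: (m iu0) => [|?]; [lia | rewrite eqxx].
  by move=> _; split; [lia | rewrite -dM -dF; nia].
have mE' m : m \in msupp (eqn D) -> lcoef sw t (eqn D) m != 0 ->
    (m (lvar (~~ sw)).1 + m (lvar (~~ sw)).2 = n)%N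
     /\ (m (lvar sw).1 + m (lvar sw).2 = E (m (lvar (~~ sw)).2))%N.
  by move=> mD /mE -/(_ mD)[eq_n eq_E]; split=> //; rewrite /n -eq_n.
have [/(lin_dvd mE')[h Dlh]|r0] := eqVneq (lrestr sw t (eqn D)) 0.
  left; have [|/unit_mpolyP[c c0 hc]] := irrD _ _ Dlh.
    by move=> /unit_mpolyP[c c0 lc]; have := msize_lin sw t; rewrite lc msizeC c0.
  by exists c => //; rewrite Dlh hc mulrC mul_mpolyC.
right=> N p L c p_inj c0 Lc.
have deg_ge0 : deg sw D = n.
  have [m mD cm] : exists2 m, m \in msupp (eqn D) & lcoef sw t (eqn D) m != 0.
    apply/hasP; apply: contraNT r0 => /hasPn no_m; rewrite /lrestr big_seq big1// => m mD.
    by move: (no_m _ mD); rewrite negbK => /eqP ->; rewrite scale0r.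
  by have [degE _] := mE _ mD cm; rewrite /n -degE.
rewrite deg_ge0 -(big_morph Posz PoszD (erefl _)) lez_nat.
pose e d j : ipoint k := (pt sw t d, nseq j (tangent k sw)).
apply: (@leq_sum_chains _ _ _ p _ (mult D) e n p_inj) => [i|s B us].
  rewrite /through /mult Lc local_eqZ// vorderZ//.
  by case: (local_eq_lin sw t (p i)) => [[[d [j ->]] _]|-> //]; exists d, j.
have szP : (size (lrestr sw t (eqn D)) <= n.+1)%N.
  apply: (leq_trans (size_sum _ _ _)).
  apply/bigmax_leqP_seq => m mD _.
  have [->|cm] := eqVneq (lcoef sw t (eqn D) m) 0; first by rewrite scale0r size_poly0.
  have [<- _] := mE' _ mD cm.
  by apply: leq_trans (size_scale_leq _ _) _; rewrite size_polyXn ltnS leq_addl.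
apply: (bezout_P1 r0 szP us) => d _.
rewrite (@binformE _ _ _ _ _ _ (fun m : 'X_{1..4} => m (lvar (~~ sw)).1)); last first.
  by move=> m mD cm; have [] := mE' _ mD cm.
rewrite -restr_local_eq0; apply: dvdp_trans (chain_dvd sw _ B).
rewrite dvdp_exp2l// leq_sum// => j _.
by rewrite /mult /e -[nseq j _]cats0 local_eq_nseq.
Qed.

Lemma proximity_ineq N (p : 'I_N -> ipoint k) D i : injective p ->
  (\sum_(j < N | proximate p j i) mult D (p j) <= mult D (p i))%N.
Proof.
move=> p_inj; set q := p i.
pose e d j : ipoint k := (q.1, nseq j (tangent k (~~ d)) ++ d :: q.2).
apply: (@leq_sum_chains _ _ _ p _ (mult D) e _ p_inj) => [j|s B us].
  by case/andP=> _ /on_exc_chain[d [n ->]]; exists d, n.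
apply: leq_trans (@exceptional_bezout k (local_eq (eqn D) q) s B us); apply: leq_sum => d _.
by apply: leq_sum => j _; rewrite /mult local_eq_nseq.
Qed.

End Divisors.
End Lines.

(** * Existence of least elements *)

Lemma leastP d (T : porderType d) (x0 a : T) (A : set T) :
  A a -> (forall b, A b -> (a <= b)%O) -> least x0 A = a.
Proof.
move=> Aa le_a; rewrite /least.
case: xgetP => [b -> [Ab le_b]|/(_ a)]; last by case.
by apply: le_anti; rewrite le_a// le_b.
Qed.

Lemma least_nat (A : set nat) n : A n ->
  A (least 0%N A) /\ forall b, A b -> (least 0%N A <= b)%N.
Proof.
move=> An; have exA : exists n, `[< A n >] by exists n; apply/asboolP.
case: (ex_minnP exA) => m /asboolP Am le_m.
have leA b : A b -> (m <= b)%N by move=> Ab; apply/le_m/asboolP.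
by rewrite (@leastP _ _ _ m) // => b /leA; rewrite leEnat.
Qed.

(** Translation by [lb] reduces this to natural numbers; the lower bound is what keeps [least] from
    returning its junk value. *)
Lemma least_int_le (A : set int) lb b : (forall a, A a -> lb <= a) -> A b ->
  least 0 A <= b.
Proof.
move=> lbA Ab; pose B := [set n : nat | A (lb + n%:Z)]%classic.
have toB a : A a -> B `|a - lb|%N.
  by move=> Aa; rewrite /B /= gez0_abs ?subr_ge0 ?lbA//; rewrite (_ : _ + _ = a)//; lia.
have [Am le_m] := least_nat (toB _ Ab).
have leA a : A a -> lb + (least 0%N B)%:Z <= a.
  move=> Aa; rewrite -lerBrDl; apply: le_trans (_ : `|a - lb|%N%:Z <= _).
    by rewrite lez_nat le_m//; apply: toB.
  by rewrite gez0_abs// subr_ge0 lbA.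
by rewrite (leastP 0 (Am : A (lb + (least 0%N B)%:Z)) leA) leA.
Qed.

(** * Points of a configuration, classes of lines and the cone *)

Section Configuration.
Variables (k : closedFieldType) (delta N : nat) (p : 'I_N -> ipoint k).
Hypothesis hp : is_config p.
Implicit Types (D : effdiv k delta) (sw r : bool).

Lemma config_inj : injective p.
Proof.
have lt_neq (i j : 'I_N) : (i < j)%N -> p i <> p j.
  move=> ltij eqp; have /andP[+ _] := hp.2 j; rewrite -eqp => /negP; apply.
  by apply/mapP; exists i; rewrite // mem_filter ltij mem_enum.
move=> i j eqp; apply: val_inj.
by case: (ltngtP i j) => // [/lt_neq/(_ eqp)|/lt_neq/(_ (esym eqp))].
Qed.

Lemma config_parent i o d ds : p i = (o, d :: ds) ->
  exists j, proximate p i j /\ p j = (o, ds).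
Proof.
move=> pi; have /andP[_] := hp.2 i; rewrite pi /=.
case/mapP=> j; rewrite mem_filter => /andP[ltji _] pj.
by exists j; rewrite /proximate ltji pi -pj on_exc_cons.
Qed.

Definition is_line sw D : Prop := exists c t, c != 0 /\ eqn D = c *: lin sw t.

Definition class_ok sw (t : P1 k) : Prop := sw -> (t == None) || (delta == 0)%N.

Lemma line_cls sw t D c : class_ok sw t -> c != 0 -> eqn D = c *: lin sw t ->
  clsF D = (if sw then - delta%:Z else 1) /\ clsM D = (if sw then 1 else 0).
Proof.
move=> ok_t c0 Dc; pose i := if t is Some _ then (lvar sw).2 else (lvar sw).1.
have lin1 : (lin sw t)@_U_(i) = 1 := lin_mcoeff sw t.
have : U_(i)%MM \in msupp (eqn D).
  by rewrite Dc mcoeff_msupp mcoeffZ lin1 mulr1.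
case/eqn_bihom; rewrite !mnm1E /i; move: ok_t; rewrite /class_ok {lin1 Dc i}.
case: sw => [ok|_]; last by case: t => [a|] /= <- <-; rewrite mulr0 subr0 ?addr0 ?add0r.
case: t ok => [a /(_ isT) /= /eqP d0 <- <-|_ /= <- <-]; last by split; lia.
by rewrite d0; split; lia.
Qed.

Lemma linsys_line sw D : (sw -> delta = 0%N) ->
  (if sw then @linsysM k delta else @linsysF k delta) D -> is_line sw D.
Proof.
move=> sw_delta Dsys; apply: linP; first exact: eqn_neq0.
move=> m /eqn_bihom eqm.
have [deg1 [j0 j1]] : (m (lvar sw).1 + m (lvar sw).2 = 1)%N
    /\ m (lvar (~~ sw)).1 = 0%N /\ m (lvar (~~ sw)).2 = 0%N.
  case: sw sw_delta Dsys eqm => [/(_ isT) d0|_] [-> ->] [] /=; last by nia.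
  by rewrite d0; lia.
have [m0|m0] : m (lvar sw).1 = 0%N \/ m (lvar sw).1 = 1%N by lia.
  right; apply/mnmP => l; rewrite mnm1E.
  have m1 : m (lvar sw).2 = 1%N by lia.
  by case: (ord4_lvar sw l) => ->; rewrite ?m0 ?m1 ?j0 ?j1; case: (sw).
left; apply/mnmP => l; rewrite mnm1E.
have m1 : m (lvar sw).2 = 0%N by lia.
by case: (ord4_lvar sw l) => ->; rewrite ?m0 ?m1 ?j0 ?j1; case: (sw).
Qed.

Lemma line_linsys sw D : (sw -> delta = 0%N) -> is_line sw D ->
  (if sw then @linsysM k delta else @linsysF k delta) D.
Proof.
move=> sw_delta [c [t [c0 Dc]]].
have ok_t : class_ok sw t by move=> /sw_delta ->; rewrite orbT.
have := line_cls ok_t c0 Dc; case: sw sw_delta {ok_t Dc} => [/(_ isT) d0|_] [eF eM].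
  by split; rewrite ?eF ?eM// d0.
by split.
Qed.

Lemma line_exists sw t : class_ok sw t -> exists L : effdiv k delta, eqn L = lin sw t.
Proof.
move=> ok_t.
have bihom : bihomogeneous delta (if sw then - delta%:Z else 1) (if sw then 1 else 0) (lin sw t).
  move=> m; case: sw ok_t => [|_].
    case: t => [a /(_ isT) /eqP ->|_]; last first.
      by rewrite /lin msuppX inE => /eqP ->; rewrite !mnm1E /=; lia.
    by move=> /(@msupp_lin k true (Some a))[] ->; rewrite !mnm1E /=; lia.
  by case/msupp_lin=> ->; rewrite !mnm1E /=; lia.
by exists (EffDiv (lin_neq0 sw t) bihom).
Qed.

Lemma through_line sw t d (L : effdiv k delta) : eqn L = lin sw t ->
  through L ((pt sw t d, [::]) : ipoint k).
Proof. by move=> Lt; rewrite /through /mult Lt /local_eq /= local_eq0_lin_pt vorder_lineq. Qed.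

Lemma mult_line_le1 sw D q : is_line sw D -> (mult D q <= 1)%N.
Proof.
move=> [c [t [c0 Dc]]]; rewrite /mult Dc local_eqZ// vorderZ//.
by case: (local_eq_lin sw t q) => [[_ ->]|->] //; rewrite vorder_lineq.
Qed.

Lemma deg_ge0 sw D : integral_div D -> ~ is_line sw D -> 0 <= deg sw D.
Proof.
move=> intD notline; have [L LN] : exists L : effdiv k delta, eqn L = lin sw None.
  by apply: line_exists.
case: (@line_bezout _ _ sw None D _ intD) => // [[c c0 Dc]|].
  by case: notline; exists c, None.
(* For an empty family of points the Bezout inequality reads [0 <= deg sw D]. *)
move=> /(_ 0%N (fun=> ((None, None), [::])) L 1).
rewrite scale1r big_ord0; apply => //; last exact: oner_neq0.
by case.
Qed.

Section Cones.
Variable R : realType.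

Definition ruling r : set (effdiv k delta) :=
  if r then @linsysM k delta else @linsysF k delta.

(** Both rulings are treated at once: [r] is the family of the fibers, [~~ r] that of the special
    section, and the coordinates [x] and [y] are exchanged accordingly. *)
Lemma in_cone_mult r D S c t : (r -> delta = 0%N) -> class_ok (~~ r) t ->
  c != 0 -> eqn S = c *: lin (~~ r) t ->
  integral_div D -> ~ is_line r D ->
  ~ (exists2 c', c' != 0 & eqn D = c' *: lin (~~ r) t) ->
  in_cone p (ruling r) S (deg (~~ r) D)%:~R (deg r D)%:~R
    (fun i => (mult D (p i))%:R : R).
Proof.
move=> r_delta ok_t c0 Sc intD notr notS; split.
- move=> i; rewrite -natr_sum ler_nat.
  exact: proximity_ineq config_inj.
- move=> F Fr _; have [c' [t' [c'0 Fc']]] := linsys_line r_delta Fr.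
  rewrite -natr_sum -[X in X <= _]/((_ : nat)%:Z%:~R) ler_int.
  case: (@line_bezout _ _ r t' D _ intD) => [/r_delta ->|[c1 c10 Dc1]|].
  + by rewrite orbT.
  + by case: notr; exists c1, t'.
  by move=> /(_ _ _ F c' config_inj c'0 Fc'); rewrite (big_morph Posz PoszD (erefl _)).
- rewrite -natr_sum -[X in X <= _]/((_ : nat)%:Z%:~R) ler_int.
  case: (@line_bezout _ _ (~~ r) t D ok_t intD) => [//|].
  by move=> /(_ _ _ S c config_inj c0 Sc); rewrite (big_morph Posz PoszD (erefl _)).
Qed.

(** Nonnegativity is a descending induction, since proximity sums involve later points only. The
    bound by [y] is an ascending one: a proper point lies on a fiber, any other is proximate to the
    point below it. *)
Lemma cone_bounds r S (x y : R) m : (r -> delta = 0%N) ->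
  in_cone p (ruling r) S x y m -> 0 <= x /\ forall i, 0 <= m i <= y.
Proof.
move=> r_delta [prox fib sec].
have m_ge0 i : 0 <= m i.
  have [n] := ubnP (N - i); elim: n i => // n IHn i lt_n.
  apply: le_trans (prox i); apply: sumr_ge0 => j /andP[ltij _]; apply: IHn.
  by have := ltn_ord j; lia.
have le_sum (J : pred 'I_N) i : J i -> m i <= \sum_(j | J j) m j.
  by move=> Ji; rewrite (bigD1 i) //= lerDl sumr_ge0.
split=> [|i]; first by apply: le_trans sec; apply: sumr_ge0.
rewrite m_ge0 /=; have [n] := ubnP i; elim: n i => // n IHn i lt_n.
case pi : (p i) => [o [|d ds]].
  pose t := if r then o.2 else o.1.
  have [L Lt] : exists L : effdiv k delta, eqn L = lin r t.
    by apply: line_exists => /r_delta ->; rewrite orbT.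
  have Li : through L (p i).
    rewrite pi; have := through_line (if r then o.1 else o.2) Lt.
    by rewrite /t /pt; case: (o) => o1 o2; case: (r).
  apply: le_trans (fib L _ _); first exact: le_sum.
    apply: line_linsys => //; exists 1, t.
    by rewrite oner_neq0 scale1r.
  by exists i; rewrite /proper pi /=; split=> //; rewrite -pi.
have [j [prox_ij _]] := config_parent pi.
apply: le_trans (IHn j _); first by apply: le_trans (prox j); apply: le_sum.
by case/andP: prox_ij; lia.
Qed.

(** By [cone_bounds], [N] itself satisfies the defining inequality, so the least value is
    attained. *)
Lemma cone_valueP r S : (r -> delta = 0%N) ->
  let t := cone_value p R (ruling r) S in
  (0 < t)%N /\ forall x y m, in_cone p (ruling r) S x y m ->
     0 <= 2 * x * y + t%:R * y ^+ 2 - \sum_(i < N) m i ^+ 2 :> R.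
Proof.
move=> r_delta; rewrite /cone_value; set A := [set t | _]%classic.
suff AN : A N by case: (least_nat AN).
split; first exact: hp.1.
move=> x y m /(cone_bounds r_delta)[x0 m_y].
have y0 : 0 <= y.
  by have /andP[m0 /(le_trans m0)] := m_y (Ordinal hp.1).
rewrite subr_ge0; apply: (@le_trans _ _ (N%:R * y ^+ 2)).
  rewrite -[N in N%:R]card_ord -sum1_card natr_sum mulr_suml ler_sum// => i _.
  by have /andP[m0 my] := m_y i; rewrite mul1r ler_sqr// nnegrE.
by rewrite lerDr !mulr_ge0.
Qed.

Lemma cone_ineq r D S c t : (r -> delta = 0%N) -> class_ok (~~ r) t ->
  c != 0 -> eqn S = c *: lin (~~ r) t ->
  integral_div D -> ~ is_line r D ->
  ~ (exists2 c', c' != 0 & eqn D = c' *: lin (~~ r) t) ->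
  \sum_(i < N) (mult D (p i))%:Z * (mult D (p i))%:Z
    <= 2 * clsF D * clsM D + (cone_value p R (ruling r) S)%:Z * deg r D ^+ 2.
Proof.
move=> r_delta ok_t c0 Sc intD notr notS.
have := (cone_valueP S r_delta).2 _ _ _ (in_cone_mult r_delta ok_t c0 Sc intD notr notS).
set v := cone_value _ _ _ _; rewrite subr_ge0 -(ler_int R) => le_v.
have -> : 2 * clsF D * clsM D = 2 * (deg (~~ r) D * deg r D).
  by rewrite /deg; case: (r); rewrite /= -mulrA // [clsM D * _]mulrC.
rewrite mulrA intrD expr2 !intrM rmorph_sum -expr2.
by apply: le_trans le_v; apply: ler_sum => i _; rewrite /= intrM expr2.
Qed.

End Cones.

End Configuration.

(** * Self-intersections of lines and exceptional curves *)

Section SelfIntersections.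
Variables (k : closedFieldType) (delta N : nat) (p : 'I_N -> ipoint k).
Hypothesis hp : is_config p.
Implicit Types (D : effdiv k delta) (sw r : bool).

Lemma dot_strict D : dot delta (strict_cls p D) (strict_cls p D)
  = 2 * clsF D * clsM D + delta%:Z * clsM D ^+ 2
    - \sum_(i < N) (mult D (p i))%:Z * (mult D (p i))%:Z.
Proof. by rewrite /dot /dotF /=; congr (_ - _); ring. Qed.

Lemma sumr_sqr_ge0 (z : 'I_N -> int) : 0 <= \sum_(i < N) z i * z i.
Proof. by apply: sumr_ge0 => i _; rewrite -expr2 sqr_ge0. Qed.

Lemma sumr_sqr_leN (z : 'I_N -> int) : (forall i, `|z i| <= 1) ->
  \sum_(i < N) z i * z i <= N%:Z.
Proof.
move=> z1; rewrite -[N in N%:Z]card_ord -sum1_card (big_morph Posz PoszD (erefl _)).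
apply: ler_sum => i _; rewrite -expr2 -[_ ^+ 2]ger0_norm ?sqr_ge0//.
by rewrite normrX expr_le1// z1.
Qed.

(** A line has self-intersection 0 or [- delta] before the blowups and loses at most 1 at each
    point. Uniformity of the bound makes [alpha] a true minimum. *)
Lemma dot_line_ge sw t c D : class_ok delta sw t -> c != 0 -> eqn D = c *: lin sw t ->
  - (delta%:Z + N%:Z) <= dot delta (strict_cls p D) (strict_cls p D).
Proof.
move=> ok_t c0 Dc; have [eF eM] := line_cls ok_t c0 Dc.
have : \sum_(i < N) (mult D (p i))%:Z * (mult D (p i))%:Z <= N%:Z.
  apply: sumr_sqr_leN => i; rewrite ger0_norm ?lez_nat//.
  by apply: (@mult_line_le1 _ _ sw); exists c, t.
by rewrite dot_strict eF eM; case: (sw) => sqN; lia.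
Qed.

Lemma curvesS_line D : curvesS p D -> exists sw t c,
  [/\ class_ok delta sw t, c != 0 & eqn D = c *: lin sw t].
Proof.
rewrite /curvesS; case: eqP => [d0|_] [].
- move=> [Dsys|Dsys] _.
    have [//|c [t [c0 Dc]]] := @linsys_line _ _ false D _ Dsys.
    by exists false, t, c.
  have [//|c [t [c0 Dc]]] := @linsys_line _ _ true D _ Dsys.
  by exists true, t, c; split=> // _; rewrite d0 orbT.
- move=> ->; exists true, None, 1; split=> //; first exact: oner_neq0.
  by rewrite scale1r.
move=> [Dsys _].
have [//|c [t [c0 Dc]]] := @linsys_line _ _ false D _ Dsys.
by exists false, t, c.
Qed.

Lemma alpha_le D : curvesS p D ->
  alpha delta p <= dot delta (strict_cls p D) (strict_cls p D).
Proof.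
move=> DS; apply: (@least_int_le _ (- (delta%:Z + N%:Z))); last by exists D.
move=> _ [D' /curvesS_line[sw [t [c [ok_t c0 Dc]]]] <-].
exact: dot_line_ge ok_t c0 Dc.
Qed.

Lemma beta_le i : beta delta p <= dot delta (exc_cls p i) (exc_cls p i).
Proof.
apply: (@least_int_le _ (- N%:Z)); last by exists i.
move=> _ [j _ <-]; rewrite /dot /dotF /= !(mul0r, mulr0) !add0r lerN2.
by apply: sumr_sqr_leN => l; case: (proximate _ _ _); case: (_ == _).
Qed.

Lemma beta_le0 : beta delta p <= 0.
Proof.
apply: le_trans (beta_le (Ordinal hp.1)) _.
by rewrite /dot /dotF /= !(mul0r, mulr0) !add0r oppr_le0 sumr_sqr_ge0.
Qed.

(** A line missing all the points keeps self-intersection 0; any other belongs to [curvesS]. *)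
Lemma alpha_le_line sw D : (sw -> delta = 0%N) -> is_line sw D ->
  0 <= dot delta (strict_cls p D) (strict_cls p D)
  \/ alpha delta p <= dot delta (strict_cls p D) (strict_cls p D).
Proof.
move=> sw_delta lineD; have Dsys := line_linsys sw_delta lineD.
have [thrD|no_thr] := pselect (through_some p D); [right | left].
  apply: alpha_le; rewrite /curvesS; case: eqP => [_|d_neq0].
    by split=> //; case: (sw) Dsys; [right | left].
  by right; split=> //; case: (sw) sw_delta Dsys => [/(_ isT)|].
have mult0 i : mult D (p i) = 0%N.
  by apply/eqP; rewrite -leqn0 leqNgt; apply/negP => ?; apply: no_thr; exists i.
rewrite dot_strict big1 => [|i _]; last by rewrite mult0.
by case: (sw) sw_delta Dsys => [/(_ isT) d0|_] [-> ->]; rewrite ?d0; lia.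
Qed.

(** [curvesS] contains the record [M0], while [D] only has a proportional equation; class and
    multiplicities agree. *)
Lemma alpha_le_M0 D c : (0 < delta)%N -> c != 0 -> eqn D = c *: lin true None ->
  alpha delta p <= dot delta (strict_cls p D) (strict_cls p D).
Proof.
move=> d_gt0 c0 Dc; suff -> : dot delta (strict_cls p D) (strict_cls p D)
    = dot delta (strict_cls p (M0 k delta)) (strict_cls p (M0 k delta)).
  by apply: alpha_le; rewrite /curvesS; case: eqP d_gt0 => [->//|_ _]; left.
have [] // := line_cls (_ : class_ok delta true None) c0 Dc.
rewrite !dot_strict => -> ->; congr (_ - _); apply: eq_bigr => i _.
by rewrite /mult Dc local_eqZ// vorderZ.
Qed.

(** As [M] is nonpositive, enlarging [y] to [h] only lowers [M * y ^+ 2]. Below, [h] is the degree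
    with respect to the nef divisor. *)
Lemma sqr_bound_quotient (M q h y : int) : M <= 0 -> 0 <= y -> y <= h -> 0 < h ->
  M * y ^+ 2 <= q -> M%:~R <= q%:~R / h%:~R ^+ 2 :> rat.
Proof.
move=> M0 y0 yh h0 le_q; rewrite ler_pdivlMr ?exprn_gt0 ?ltr0z//.
rewrite -rmorphXn -intrM ler_int; apply: le_trans le_q.
by rewrite ler_wnM2l// ler_sqr// nnegrE ltW.
Qed.

End SelfIntersections.

(** * The value [omega] on the product of two lines *)

Section Omega.
Variables (k : closedFieldType) (delta N : nat) (p : 'I_N -> ipoint k).
Hypothesis delta0 : delta = 0%N.
Hypothesis hp : is_config p.
Variable R : realType.

(* [r = false] is a_1 and [r = true] is a_2. *)
Lemma omega0_ge r : exists2 S : effdiv k delta, ruling (~~ r) S &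
  (cone_value p R (@ruling k delta r) S)%:Z <= omega delta p R.
Proof.
pose A := [set cone_value p R (@ruling k delta r) S | S in @ruling k delta (~~ r)]%classic.
have [S0 S0sys] : exists S, @ruling k delta (~~ r) S.
  have [L LN] : exists L : effdiv k delta, eqn L = lin (~~ r) None by exact: line_exists.
  exists L; apply: line_linsys => //; exists 1, None.
  by rewrite scale1r oner_neq0.
have [[S Ssys eqS] _] : A (least 0%N A) /\ forall b, A b -> (least 0%N A <= b)%N.
  by apply: (@least_nat _ (cone_value p R (@ruling k delta r) S0)); exists S0.
exists S => //; rewrite eqS /omega; case: eqP => // _; rewrite lez_nat.
by rewrite /A; case: (r); [exact: leq_maxr | exact: leq_maxl].
Qed.

End Omega.

(** * The lower bounds for all integral curves *)

Theorem theorem3p6 (k : closedFieldType) (R : realType) (delta N : nat)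
    (p : 'I_N -> ipoint k) (hp : is_config p) :
  ((0 < delta)%N -> (aval delta p R <= delta)%N ->
     forall C : zcurve k delta N,
       Num.min (alpha delta p) (beta delta p)
         <= dot delta (curve_cls p C) (curve_cls p C))
  /\
  (delta = 0%N \/ ((0 < delta)%N /\ (delta < aval delta p R)%N) ->
     forall h : int * int, nef k delta h ->
     forall C : zcurve k delta N,
       0 < dot delta (pullback N h) (curve_cls p C) ->
       (Num.min (alpha delta p) (- omega delta p R))%:~R
         <= (dot delta (curve_cls p C) (curve_cls p C))%:~R
            / (dot delta (pullback N h) (curve_cls p C))%:~R ^+ 2 :> rat).
Proof.
have M0E : eqn (M0 k delta) = 1 *: lin true None by rewrite scale1r.
have okN sw : class_ok delta sw (None : P1 k) by [].
have no_swap : false -> delta = 0%N by [].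
have one0 : (1 : k) != 0 := oner_neq0 k.
split=> [d_gt0 le_a C|hd h nef_h C].
  rewrite ge_min; case: C => [D intD|i] /=; last by rewrite beta_le// orbT.
  have [/(alpha_le_line p)|notF] := pselect (is_line false D).
    case=> // [ge0|->//]; apply/orP; right; exact: le_trans (beta_le0 delta hp) ge0.
  have [[c c0 Dc]|notM] := pselect (exists2 c, c != 0 & eqn D = c *: lin true None).
    by rewrite (alpha_le_M0 p d_gt0 c0 Dc).
  (* For the remaining curves, replacing [aval] by the larger [delta] turns the cone inequality into
     nonnegativity of the self-intersection, and [beta] is nonpositive. *)
  apply/orP; right; apply: le_trans (beta_le0 delta hp) _; rewrite dot_strict.
  have := cone_ineq hp R (r := false) no_swap (okN true) one0 M0E intD notF notM.
  rewrite -[cone_value _ _ _ _]/(aval delta p R) /= subr_ge0 => /le_trans -> //.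
  by rewrite lerD2l ler_wpM2r ?sqr_ge0 ?lez_nat.
set M := Num.min _ _; set H := dot _ (pullback _ _) _ => H_gt0.
(* Nefness is tested on a fiber, which gives [h.2], and then on [M_0], which gives [h.1]. *)
have h2_ge0 : 0 <= h.2.
  have [L LE] : exists L : effdiv k delta, eqn L = lin false None by exact: line_exists.
  have intL : integral_div L by apply: msize2_integral; rewrite LE msize_lin.
  have [] // := line_cls (okN false) one0 (_ : eqn L = 1 *: lin false None).
    by rewrite scale1r.
  by move=> eF eM; have := nef_h L intL; rewrite /dotF eF eM /=; lia.
have h1_ge0 : 0 <= h.1.
  have intM0 : integral_div (M0 k delta).
    by apply: msize2_integral; rewrite M0E scale1r msize_lin.
  by have := nef_h _ intM0; rewrite /dotF /=; lia.
have omega_ge0 : 0 <= omega delta p R.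
  by rewrite /omega; case: eqP hd => [//|d_neq0] [//|[_ lt_a]]; rewrite subr_ge0 lez_nat ltnW.
have M_le0 : M <= 0 by rewrite ge_min oppr_le0 omega_ge0 orbT.
have M_alpha : M <= alpha delta p by rewrite ge_min lexx.
have M_omega : M <= - omega delta p R by rewrite ge_min lexx orbT.
case: C @H H_gt0 => [D intD|i] H H_gt0 /=; last first.
  (* The pullback is orthogonal to the exceptional curves, contradicting [H_gt0]. *)
  by move: H_gt0; rewrite /H /dot /dotF /= big1 => [|? _]; rewrite !(mul0r, mulr0, addr0).
have HE : H = h.1 * clsM D + h.2 * clsF D + delta%:Z * (h.2 * clsM D).
  by rewrite /H /dot /dotF /= big1 ?subr0// => i _; rewrite mul0r.
have line_case : 0 <= dot delta (strict_cls p D) (strict_cls p D)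
    \/ alpha delta p <= dot delta (strict_cls p D) (strict_cls p D) ->
  M%:~R <= (dot delta (strict_cls p D) (strict_cls p D))%:~R / H%:~R ^+ 2 :> rat.
  case=> [ge0|/(le_trans M_alpha) ge_M].
    apply: (@sqr_bound_quotient _ _ _ 0) => //; first exact: ltW.
    by rewrite expr0n mulr0.
  by apply: (@sqr_bound_quotient _ _ _ 1) => //; rewrite expr1n mulr1.
have bound y : 0 <= y -> y <= H ->
    - omega delta p R * y ^+ 2 <= dot delta (strict_cls p D) (strict_cls p D) ->
  M%:~R <= (dot delta (strict_cls p D) (strict_cls p D))%:~R / H%:~R ^+ 2 :> rat.
  move=> y0 yH le_d; apply: (@sqr_bound_quotient _ _ _ y) => //.
  by apply: le_trans le_d; rewrite ler_wpM2r ?sqr_ge0.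
have [/(alpha_le_line p) lineF|notF] := pselect (is_line false D).
  by apply: line_case; apply: lineF.
have y_ge0 := deg_ge0 intD notF; rewrite /= in y_ge0.
case: hd => [d0|[d_gt0 lt_a]].
  have [/(alpha_le_line p) lineM|notM] := pselect (is_line true D).
    by apply: line_case; apply: lineM.
  have x_ge0 := deg_ge0 intD notM; rewrite /= in x_ge0.
  have dz : delta%:Z = 0 by rewrite d0.
  have ge_omega r : - omega delta p R * deg r D ^+ 2
      <= dot delta (strict_cls p D) (strict_cls p D).
    have [S Ssys le_omega] := omega0_ge p d0 R r.
    have all_ok sw (t : P1 k) : class_ok delta sw t by move=> _; rewrite d0 orbT.
    have [//|c [t [c0 St]]] := linsys_line (sw := ~~ r) _ Ssys.
    have notr : ~ is_line r D by case: (r).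
    have notS : ~ (exists2 c', c' != 0 & eqn D = c' *: lin (~~ r) t).
      move=> [c' c'0 Dc']; have : is_line (~~ r) D by exists c', t.
      by case: (r).
    have := cone_ineq hp R (r := r) (fun=> d0) (all_ok _ _) c0 St intD notr notS.
    rewrite dot_strict dz mul0r addr0 => le_sum.
    rewrite mulNr lerNl opprB lerBlDl; apply: le_trans le_sum _.
    by rewrite lerD2l ler_wpM2r ?sqr_ge0.
  (* The ruling is chosen so that the degree along it is at most [H]: the coefficient [h.1]
     multiplies [clsM D] and [h.2] multiplies [clsF D]. *)
  have [h1_gt0|h1_le0] := ltP 0 h.1.
    by apply: (bound _ _ _ (ge_omega false)) => //; rewrite HE dz /=; nia.
  have h1_0 : h.1 = 0 by apply: le_anti; rewrite h1_le0.
  apply: (bound _ _ _ (ge_omega true)) => //.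
  have h2_gt0 : 0 < h.2.
    rewrite lt_def h2_ge0 andbT; apply: contraTneq H_gt0 => h2_0.
    by rewrite HE dz h1_0 h2_0 !mul0r.
  by rewrite HE dz h1_0 !mul0r add0r addr0 ler_peMl.
have [[c c0 Dc]|notM] := pselect (exists2 c, c != 0 & eqn D = c *: lin true None).
  by apply: line_case; right; apply: (alpha_le_M0 p d_gt0 c0 Dc).
(* Only the line [lin true None] is excluded here, which is less than [deg_ge0] asks; the empty
   family of points is used again. *)
have x_ge0 : 0 <= clsF D.
  have [] // := line_bezout (okN true) intD.
  move=> /(_ 0%N (fun=> ((None, None), [::])) (M0 k delta) 1).
  by rewrite big_ord0; apply => //; case.
apply: (bound (clsM D)) => //.
  have [h1_gt0|h1_le0] := ltP 0 h.1.
    by rewrite HE -addrA -[leLHS]addr0 lerD ?ler_peMl// addr_ge0 ?mulr_ge0.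
  (* Now [H] is [h.2 * clsF D + delta * h.2 * clsM D] with [delta * h.2] at least 1. *)
  have h1_0 : h.1 = 0 by apply: le_anti; rewrite h1_le0.
  have h2_gt0 : 0 < h.2.
    rewrite lt_def h2_ge0 andbT; apply: contraTneq H_gt0 => h2_0.
    by rewrite HE h1_0 h2_0 !mul0r mulr0.
  by rewrite HE h1_0 mul0r add0r -[leLHS]add0r lerD ?mulr_ge0// mulrA ler_peMl// mulr_ege1.
(* Trading [aval] for [delta] in the cone inequality costs exactly [omega * clsM D ^+ 2]. *)
have := cone_ineq hp R (r := false) no_swap (okN true) one0 M0E intD notF notM.
rewrite -[cone_value _ _ _ _]/(aval delta p R) dot_strict /omega.
case: eqP => [d0|_ le_sum]; first by rewrite d0 ltnn in d_gt0.
rewrite opprB mulrBl lerBrDr addrAC lerBlDr [leRHS]addrAC.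
by rewrite [leLHS]addrC lerD2r.
Qed.
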